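(* There are absolute constants $\delta_1 > 0$, $K > 0$ and $c > 0$ such that for all integers $r \ge 1$, $B \ge 1$ and $m$ with $m \ge K B^2 \log m$, \[ D_{\sigma^r, \delta_1}(\mathsf{Multi}\ell_\infty^{r,B}) \ge c \cdot \frac{rm}{B^2}. \]
   Context: $\mathsf{Gap}\ell_\infty^B$: Alice holds $x \in \{0,\dots,B\}^m$, Bob holds $y \in \{0,\dots,B\}^m$, with the promise that either (NO) $|x_i - y_i| \in \{0,1\}$ for all $i$, or (YES) there is a unique $i$ with $|x_i - y_i| = B$ and $|x_j - y_j| \in \{0,1\}$ for all $j \neq i$; the answer is NO or YES accordingly. The distribution $\sigma$ (on $\mathsf{Gap}\ell_\infty^B$ instances): independently for each $j \in [m]$ choose $(Z_j,P_j)$ uniformly from $(\{0,\dots,B\}\times\{0,1\}) \setminus \{(0,1),(B,0)\}$; if $(Z_j,P_j)=(z,0)$ set $X_j = z$ and $Y_j$ uniform in $\{z,z+1\}$; if $(Z_j,P_j)=(z,1)$ set $Y_j = z$ and $X_j$ uniform in $\{z-1,z\}$; then pick $S\in[m]$ uniformly and replace $(X_S,Y_S)$ by a uniform element of $\{(0,0),(0,B)\}$. $\mathsf{Multi}\ell_\infty^{r,B}$: Alice holds $x^1,\dots,x^r$, Bob holds $y^1,\dots,y^r$, where each $(x^i,y^i)$ is a valid $\mathsf{Gap}\ell_\infty^B$ instance; they must output $v \in \{NO, YES\}^r$ such that $v_i = \mathsf{Gap}\ell_\infty^B(x^i,y^i)$ for at least a $1-\delta_1$ fraction of $i \in [r]$.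 $\sigma^r$ is the product distribution of $r$ independent draws from $\sigma$. $D_{\sigma^r,\delta_1}(\mathsf{Multi}\ell_\infty^{r,B})$ is the minimum, over deterministic two-party protocols that (with inputs drawn from $\sigma^r$) with probability at least $1-\delta_1$ output a vector correct on at least a $1-\delta_1$ fraction of coordinates, of the maximum number of bits communicated.
   Formalization: The case B = 1 is excluded: there the NO and YES cases overlap (one coordinate differing by 1), so the problem is ill-defined, and for large m a constant NO output with no communication succeeds; the bound is proved for all B ≥ 2. *)

(* Defs.v *)
From HB Require Import structures.
From mathcomp Require Import all_boot all_order all_algebra.
From mathcomp Require Import all_classical all_reals all_analysis.

Set Implicit Arguments.
Unset Strict Implicit.
Unset Printing Implicit Defensive.

Import Order.TTheory GRing.Theory Num.Theory.

Local Open Scope ring_scope.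

(* Deterministic two-party protocols with output in O: at an inner node the
   owner sends one bit computed from its own input ([true] continues in the
   first subtree); the output is the leaf label, so it is determined by the
   transcript. *)
Inductive protocol (X Y O : Type) : Type :=
| Output of O
| AliceSends of (X -> bool) & protocol X Y O & protocol X Y O
| BobSends of (Y -> bool) & protocol X Y O & protocol X Y O.

Fixpoint run (X Y O : Type) (p : protocol X Y O) (x : X) (y : Y) : O :=
  match p with
  | Output o => o
  | AliceSends a p1 p0 => if a x then run p1 x y else run p0 x y
  | BobSends b p1 p0 => if b y then run p1 x y else run p0 x y
  end.

Fixpoint bits (X Y O : Type) (p : protocol X Y O) (x : X) (y : Y) : nat :=
  match p with
  | Output _ => 0
  | AliceSends a p1 p0 => (if a x then bits p1 x y else bits p0 x y).+1
  | BobSends b p1 p0 => (if b y then bits p1 x y else bits p0 x y).+1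
  end.

Definition max_bits (X Y : finType) (O : Type) (p : protocol X Y O) : nat :=
  \max_(w : X * Y) bits p w.1 w.2.

Definition vec (B m : nat) := {ffun 'I_m -> 'I_B.+1}.
Definition vecs (r B m : nat) := {ffun 'I_r -> vec B m}.

Definition NO := false.
Definition YES := true.

Definition dist_at (B m : nat) (x y : vec B m) (i : 'I_m) : nat :=
  `|(x i : nat)%:Z - (y i : nat)%:Z|%N.

Definition gap_no (B m : nat) (x y : vec B m) : Prop :=
  forall i, dist_at x y i \in [:: 0; 1]%N.

Definition gap_yes (B m : nat) (x y : vec B m) : Prop :=
  exists i, unique (fun j => dist_at x y j = B) i /\
            forall j, j <> i -> dist_at x y j \in [:: 0; 1]%N.

(* The promise problem as a function: [gap] answers NO or YES accordingly, and
   is arbitrary where the promise fails. For 2 <= B the two cases are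
   disjoint, and all such functions agree on valid instances. For B = 1 and
   0 < m the cases overlap (one coordinate at distance 1, the others equal),
   so the problem is ill-posed and no function satisfies this. *)
Definition is_gap_linf (B m : nat) (gap : vec B m -> vec B m -> bool) : Prop :=
  forall x y, (gap_no x y -> gap x y = NO) /\ (gap_yes x y -> gap x y = YES).

Section Distributions.
Variable R : realType.

Definition unif (T : finType) (A : {set T}) (t : T) : R :=
  (t \in A)%:R / #|A|%:R.

(* Range of (Z_j, P_j), with P_j = 1 encoded as [true]. *)
Definition ZP_range (B : nat) : {set 'I_B.+1 * bool} :=
  [set~ (ord0, true)] :\ (ord_max, false).

(* Range of (X_j, Y_j) given (Z_j, P_j): {(z,z), (z,z+1)} if P_j = 0 and
   {(z-1,z), (z,z)} if P_j = 1. *)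
Definition XY_range (B : nat) (zp : 'I_B.+1 * bool) :
    {set 'I_B.+1 * 'I_B.+1} :=
  let z := zp.1 in
  if zp.2
  then [set w | (w.2 == z) && ((w.1 == z) || (w.1.+1 == z :> nat))]
  else [set w | (w.1 == z) && ((w.2 == z) || (w.2 == z.+1 :> nat))].

Definition coord_law (B : nat) (w : 'I_B.+1 * 'I_B.+1) : R :=
  \sum_(zp : 'I_B.+1 * bool) unif (ZP_range B) zp * unif (XY_range zp) w.

Definition replace (B m : nat) (x : vec B m) (s : 'I_m) (a : 'I_B.+1) :
    vec B m :=
  [ffun j => if j == s then a else x j].

Definition planted (B : nat) : {set 'I_B.+1 * 'I_B.+1} :=
  [set (ord0, ord0); (ord0, ord_max)].

Definition sigma (B m : nat) (xy : vec B m * vec B m) : R :=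
  \sum_(xy0 : vec B m * vec B m) \sum_(s : 'I_m)
    \sum_(ab : 'I_B.+1 * 'I_B.+1)
      (\prod_(j < m) coord_law (xy0.1 j, xy0.2 j)) *
      unif [set: 'I_m] s * unif (planted B) ab *
      (xy == (replace xy0.1 s ab.1, replace xy0.2 s ab.2))%:R.

Definition sigma_pow (r B m : nat) (xy : vecs r B m * vecs r B m) : R :=
  \prod_(i < r) sigma (xy.1 i, xy.2 i).

Definition multi_correct (r B m : nat) (gap : vec B m -> vec B m -> bool)
    (delta : R) (x y : vecs r B m) (v : {ffun 'I_r -> bool}) : bool :=
  (1 - delta) * r%:R <= #|[set i | v i == gap (x i) (y i)]|%:R.

Definition solves_multi (r B m : nat) (gap : vec B m -> vec B m -> bool)
    (mu : vecs r B m * vecs r B m -> R) (delta : R)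
    (p : protocol (vecs r B m) (vecs r B m) {ffun 'I_r -> bool}) : Prop :=
  1 - delta <=
    \sum_(w | multi_correct gap delta w.1 w.2 (run p w.1 w.2)) mu w.

(* A minimum of natural numbers; +oo if no protocol succeeds. *)
Definition D_multi (r B m : nat) (gap : vec B m -> vec B m -> bool)
    (mu : vecs r B m * vecs r B m -> R) (delta : R) : \bar R :=
  ereal_inf [set (max_bits p)%:R%:E | p in solves_multi gap mu delta].

End Distributions.

(* Main.v *)
Require Import Defs.
From HB Require Import structures.
From mathcomp Require Import all_boot all_order all_algebra.
From mathcomp Require Import all_classical all_reals all_analysis.
From mathcomp Require Import ring lra zify.

Set Implicit Arguments.
Unset Strict Implicit.
Unset Printing Implicit Defensive.

Import Order.TTheory GRing.Theory Num.Theory.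

Local Open Scope ring_scope.

(* A pair drawn from the law of one coordinate is a uniform step of the
   staircase (0,0), (0,1), (1,1), (1,2), ..., (B,B): a uniform step number
   k < 2B, which plays the role of (Z,P), and a uniform bit saying which end of
   the step is taken. Given the step numbers and the planted data, a transcript
   of at most l bits partitions the cube of bits, and by the level-1 inequality
   the squared biases of the bits, averaged over the transcript, sum to at most
   8 l. Fix a copy planted with (0,0), and one of its other coordinates. The
   biases there bound the Hellinger distances along the staircase, so the
   triangle inequality, cut-and-paste and the Pythagorean property show that
   their average over the 2B steps is at least of order 1/B^2, unless the
   protocol errs on the copy with either (0,0) or (0,B) planted at this
   coordinate. The additional (0,0) is harmless: the walk has about m/(4B)
   coordinates at (0,0), and planting one more at a uniform place changes its
   law by O(sqrt(B/m)) in total variation. Summing over all coordinates gives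
   l >= c r m / B^2. When m = 1 there is no other coordinate, and the bias of
   the planted answers themselves gives l >= c r. *)

(** * Uniform averages over finite types *)

Section Mean.
Variable R : realType.
Implicit Types S T : finType.

Definition mean T (F : T -> R) : R := (\sum_t F t) / #|T|%:R.

Lemma eq_mean T (F G : T -> R) : F =1 G -> mean F = mean G.
Proof. by move=> FG; congr (_ / _); apply: eq_bigr. Qed.

Lemma le_mean T (F G : T -> R) : (forall t, F t <= G t) -> mean F <= mean G.
Proof. by move=> FG; rewrite ler_wpM2r ?invr_ge0 ?ler0n// ler_sum. Qed.

Lemma mean_ge0 T (F : T -> R) : (forall t, 0 <= F t) -> 0 <= mean F.
Proof. by move=> F0; rewrite divr_ge0 ?ler0n ?sumr_ge0. Qed.

Lemma meanD T (F G : T -> R) : mean (fun t => F t + G t) = mean F + mean G.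
Proof. by rewrite /mean big_split mulrDl. Qed.

Lemma meanZ T (a : R) (F : T -> R) : mean (fun t => a * F t) = a * mean F.
Proof. by rewrite /mean -mulr_sumr mulrA. Qed.

Lemma meanB T (F G : T -> R) : mean (fun t => F t - G t) = mean F - mean G.
Proof. by rewrite /mean sumrB mulrBl. Qed.

Lemma mean_sum T (I : finType) (P : pred I) (F : I -> T -> R) :
  mean (fun t => \sum_(i | P i) F i t) = \sum_(i | P i) mean (F i).
Proof. by rewrite /mean exchange_big/= mulr_suml. Qed.

Lemma mean_cst T (a : R) : (0 < #|T|)%N -> mean (fun _ : T => a) = a.
Proof. by move=> T0; rewrite /mean sumr_const -[a *+ _]mulr_natr mulfK // pnatr_eq0 -lt0n.
Qed.

Lemma exchange_mean S T (F : S -> T -> R) :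
  mean (fun s => mean (F s)) = mean (fun t => mean (F^~ t)).
Proof. by rewrite /mean -!mulr_suml exchange_big/= mulrAC. Qed.

Lemma mean_pair S T (F : S * T -> R) :
  mean F = mean (fun s => mean (fun t => F (s, t))).
Proof.
rewrite /mean -mulr_suml pair_bigA/= card_prod natrM invfM.
by rewrite [_^-1 * _^-1]mulrC mulrA; do 2!congr (_ * _); apply: eq_bigr => -[].
Qed.

Lemma mean_reindex S T (h : S -> T) (F : T -> R) :
  bijective h -> mean F = mean (F \o h).
Proof.
move=> bh; rewrite /mean (bij_eq_card bh); congr (_ / _).
by rewrite (reindex h)//; apply: onW_bij.
Qed.

Lemma mean_bool (F : bool -> R) : mean F = (F true + F false) / 2.
Proof. by rewrite /mean big_bool/= card_bool. Qed.

Definition upd (I : finType) T (f : {ffun I -> T}) (i : I) (a : T) :=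
  [ffun j => if j == i then a else f j].

Lemma upd_id (I : finType) T (f : {ffun I -> T}) i a : upd f i a i = a.
Proof. by rewrite ffunE eqxx. Qed.

Lemma upd_neq (I : finType) T (f : {ffun I -> T}) i j a :
  j != i -> upd f i a j = f j.
Proof. by rewrite ffunE => /negPf->. Qed.

(** Swapping [f i] with the fresh value [a] is an involution on pairs [(f, a)]. *)
Lemma mean_resample (I A : finType) (i : I) (G : {ffun I -> A} -> R) :
  (0 < #|A|)%N -> mean G = mean (fun f => mean (fun a => G (upd f i a))).
Proof.
move=> A0; rewrite -(mean_pair (fun w => G (upd w.1 i w.2))).
pose h (w : {ffun I -> A} * A) := (upd w.1 i w.2, w.1 i).
have hK : involutive h.
  move=> [f a]; rewrite /h/= upd_id; congr (_, _).
  by apply/ffunP => j; rewrite !ffunE; case: eqP => [->|].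
rewrite [RHS](eq_mean (G := (fun w => G w.1) \o h))//.
rewrite -mean_reindex; last exact: inv_bij.
by rewrite mean_pair; apply: eq_mean => f /=; rewrite mean_cst.
Qed.

(** Swapping the coordinates outside [D] between two independent copies is an involution; it turns
    [F f * G g] into a product evaluated at a single point. *)
Lemma mean_indep (I A : finType) (D : pred I) (F G : {ffun I -> A} -> R) :
  (0 < #|A|)%N ->
  (forall f g : {ffun I -> A}, {in D, f =1 g} -> F f = F g) ->
  (forall f g : {ffun I -> A}, {in predC D, f =1 g} -> G f = G g) ->
  mean (fun f => F f * G f) = mean F * mean G.
Proof.
move=> A0 FD GD.
have T0 : (0 < #|{ffun I -> A}|)%N by rewrite card_ffun expn_gt0 A0.
pose mix (f g : {ffun I -> A}) := [ffun i => if D i then f i else g i].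
pose h (w : {ffun I -> A} * {ffun I -> A}) := (mix w.1 w.2, mix w.2 w.1).
have hK : involutive h.
  move=> [f g]; rewrite /h/= /mix; congr (_, _); apply/ffunP => j; rewrite !ffunE/=;
    by case: ifP => Dj; rewrite ?Dj.
have -> : mean F * mean G = mean (fun w : _ * _ => F w.1 * G w.2).
  by rewrite mean_pair/= mulrC -meanZ; apply: eq_mean => f; rewrite meanZ mulrC.
rewrite (mean_reindex _ (inv_bij hK)) mean_pair; apply: eq_mean => f /=.
rewrite -[LHS](mean_cst _ T0); apply: eq_mean => g; congr (_ * _).
  by apply: FD => i Di; rewrite /mix ffunE ifT.
by apply: GD => i Di; rewrite /mix ffunE ifN.
Qed.

(** * Exponential moments of independent signs and the level-1 inequality *)

Lemma exp_le (x : R) : x <= 2^-1 -> expR x <= 1 + x + 2 * x ^+ 2.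
Proof.
move=> x2; have h : 1 - x <= expR (- x) by exact: expR_ge1Dx.
rewrite -[expR x]invrK -expRN; apply: (@le_trans _ _ (1 - x)^-1).
  by rewrite lef_pV2 ?posrE ?expR_gt0//; lra.
(* Here [(1 - x) (1 + x + 2 x^2) = 1 + x^2 (1 - 2 x) >= 1]. *)
rewrite -[leLHS]mul1r ler_pdivrMr; nra.
Qed.

Lemma expR_sum (I : finType) (F : I -> R) :
  expR (\sum_i F i) = \prod_i expR (F i).
Proof. by elim/big_ind2 : _ => //[|? ? ? ? <- <-]; rewrite ?expR0 ?expRD. Qed.

Definition chi (b : bool) : R := if b then -1 else 1.

(** The mean factors over the coordinates, and each factor is [cosh (b j) <= 1 + 2 (b j)^2 <= exp (2
    (b j)^2)]. *)
Lemma mean_exp_signs (J : finType) (b : J -> R) : (forall j, `|b j| <= 2^-1) ->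
  mean (fun u : {ffun J -> bool} => expR (\sum_j b j * chi (u j))) <=
  expR (\sum_j 2 * b j ^+ 2).
Proof.
move=> b1; rewrite expR_sum /mean.
under [X in X / _]eq_bigr do rewrite expR_sum.
rewrite -(bigA_distr_bigA (fun j c => expR (b j * chi c))) /=.
rewrite card_ffun card_bool natrX.
have -> : (2 ^+ #|J|)^-1 = \prod_(j : J) 2^-1 :> R.
  by rewrite prodr_const exprVn.
rewrite -big_split/=; apply: ler_prod => j _.
have /ler_normlP[? ?] := b1 j.
rewrite big_bool/= mulr1 mulrN1; apply/andP; split.
  by rewrite divr_ge0// addr_ge0// expR_ge0.
apply: (@le_trans _ _ (1 + 2 * b j ^+ 2)); last exact: expR_ge1Dx.
have : expR (b j) <= 1 + b j + 2 * (b j) ^+ 2 by apply: exp_le; lra.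
have : expR (- b j) <= 1 - b j + 2 * (- b j) ^+ 2 by apply: exp_le; lra.
rewrite sqrrN; lra.
Qed.

(* Jensen's inequality bounds the mean of [A u * expR (L u)] from below, and the
   moment generating function of independent signs bounds it from above. *)
Lemma bias_exp (J : finType) (A : {ffun J -> bool} -> R) (p : R) (b : J -> R) :
  (forall u, 0 <= A u <= 1) -> p = mean A ->
  (forall j, mean (fun u => A u * chi (u j)) = p * b j) ->
  (forall j, `|b j| <= 1) ->
  p * expR ((\sum_j b j ^+ 2) / 8) <= 1.
Proof.
move=> A01 pE bE b1; set S := \sum_j _.
(* The factor 1/4 brings the coefficients below 1/2, as [mean_exp_signs] requires; the exponents are
   then [S / 4] in the lower bound and [S / 8] in the upper one. *)
pose L (u : {ffun J -> bool}) := \sum_j 4^-1 * b j * chi (u j).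
have mL : mean (fun u => A u * (1 + (L u - S / 4))) = p.
  rewrite (eq_mean (G := fun u => (1 - S / 4) * A u +
     4^-1 * \sum_j b j * (A u * chi (u j)))); last first.
    move=> u; rewrite (_ : \sum_j _ = 4 * (A u * L u)); first by field.
    by rewrite /L !mulr_sumr; apply: eq_bigr => j _; field.
  rewrite meanD !meanZ mean_sum -pE (eq_bigr (fun j => p * b j ^+ 2)).
    by rewrite -mulr_sumr -/S; field.
  by move=> j _; rewrite meanZ bE; ring.
have low : p * expR (S / 4) <= mean (fun u => A u * expR (L u)).
  rewrite -mL mulrC -meanZ; apply: le_mean => u; have /andP[A0 _] := A01 u.
  rewrite mulrCA ler_wpM2l//.
  have -> : expR (L u) = expR (S / 4) * expR (L u - S / 4).
    by rewrite -expRD; congr expR; ring.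
  by rewrite ler_wpM2l ?expR_ge0// expR_ge1Dx.
have up : mean (fun u => A u * expR (L u)) <= expR (S / 8).
  apply: (@le_trans _ _ (mean (fun u => expR (L u)))).
    by apply: le_mean => u; have /andP[_ A1] := A01 u; rewrite ler_piMl ?expR_ge0.
  apply: le_trans (mean_exp_signs _) _ => [j|].
    by rewrite normrM ger0_norm; have := b1 j; lra.
  rewrite ler_expR le_eqVlt; apply/orP; left; apply/eqP.
  by rewrite /S mulr_suml; apply: eq_bigr => j _; field.
have := le_trans low up.
have -> : S / 4 = S / 8 + S / 8 by field.
by rewrite expRD mulrA -[leRHS]mul1r ler_pM2r ?expR_gt0.
Qed.

(* Classes [t] of mean 0 contribute 0, since x / 0 = 0. *)
Lemma level1 (J T : finType) (A : T -> {ffun J -> bool} -> R) (l : nat) :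
  (forall t u, 0 <= A t u) -> (forall u, \sum_t A t u = 1) ->
  (#|T| <= 2 ^ l)%N ->
  \sum_t \sum_j mean (fun u => A t u * chi (u j)) ^+ 2 / mean (A t) <=
  8 * l%:R.
Proof.
move=> A0 A1 Tl.
pose p t := mean (A t).
pose d t j := mean (fun u => A t u * chi (u j)).
have T0 : (0 < #|{ffun J -> bool}|)%N by rewrite card_ffun card_bool expn_gt0.
have p0 t : 0 <= p t by exact: mean_ge0.
have sp : \sum_t p t = 1.
  by rewrite -mean_sum (eq_mean (G := fun=> 1))// mean_cst.
have dp t j : `|d t j| <= p t.
  rewrite ler_norml -mulN1r -meanZ; apply/andP; split; apply: le_mean => u;
    have := A0 t u; rewrite /chi; case: ifP => _; lra.
(* The shift by [l] makes the right-hand sides sum to at most [2^l exp(-l) <= 1], while the weights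
   [p t] on the left sum to 1. *)
have key t : p t * (1 + (\sum_j (d t j / p t) ^+ 2) / 8 - l%:R) <= expR (- l%:R).
  set S := \sum_j _.
  apply: (@le_trans _ _ (p t * expR (S / 8) * expR (- l%:R))).
    by rewrite -mulrA ler_wpM2l// -expRD -addrA expR_ge1Dx.
  rewrite ler_piMl ?expR_ge0//.
  apply: (@bias_exp _ (A t)) => // [u|j|j].
  - by rewrite A0/= -(A1 u) (bigD1 t)//= lerDl sumr_ge0.
  - have [pt0|pt0] := eqVneq (p t) 0; last by rewrite mulrCA divff// mulr1.
    by rewrite pt0 mul0r; apply/eqP; rewrite -normr_le0 -pt0 dp.
  - rewrite normrM normfV (ger0_norm (p0 t)).
    have [->|pt0] := eqVneq (p t) 0; first by rewrite invr0 mulr0.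
    by rewrite ler_pdivrMr ?mul1r// lt_def pt0 p0.
have : \sum_t p t * (1 + (\sum_j (d t j / p t) ^+ 2) / 8 - l%:R) <= 1.
  apply: le_trans (ler_sum _ (fun t _ => key t)) _.
  rewrite sumr_const -[expR _ *+ _]mulr_natl expRN ler_pdivrMr ?expR_gt0// mul1r.
  apply: (@le_trans _ _ (2 ^+ l)); first by rewrite -natrX ler_nat.
  rewrite -[l%:R]mulr1 expRM_natl lerXn2r ?nnegrE ?expR_ge0//.
  by have := expR_ge1Dx (1 : R).
have -> : \sum_t p t * (1 + (\sum_j (d t j / p t) ^+ 2) / 8 - l%:R) =
  (1 - l%:R) + (\sum_t \sum_j d t j ^+ 2 / p t) / 8.
  rewrite (eq_bigr (fun t => (1 - l%:R) * p t + (\sum_j d t j ^+ 2 / p t) / 8)).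
    by rewrite big_split -mulr_sumr sp mulr1 mulr_suml.
  move=> t _; rewrite (_ : \sum_j d t j ^+ 2 / p t =
    p t * \sum_j (d t j / p t) ^+ 2); first by ring.
  rewrite mulr_sumr; apply: eq_bigr => j _.
  have [->|pt0] := eqVneq (p t) 0; first by rewrite invr0 mulr0 mul0r.
  by field.
by rewrite -/p; rewrite -/d; lra.
Qed.

End Mean.

(** * Leaves of a protocol as combinatorial rectangles *)

(** Induction on the bit bound. It may fail on inputs that never reach the current subtree, so [DX]
    and [DY] record those that do; each sent bit splits one of them. *)
Lemma protocol_rectangles (X Y O : Type) (p : protocol X Y O) (n : nat)
    (DX : pred X) (DY : pred Y) :
  (forall x y, DX x -> DY y -> (bits p x y <= n)%N) ->
  exists (T : finType) (a : T -> X -> bool) (b : T -> Y -> bool) (out : T -> O),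
    (#|T| <= 2 ^ n)%N /\
    (forall x y, DX x -> DY y -> exists t, run p x y = out t /\
      forall t', a t' x && b t' y = (t' == t)).
Proof.
elim: p n DX DY => [ o |f p1 IH1 p0 IH0|f p1 IH1 p0 IH0] [|n] DX DY le_n.
- exists unit, (fun _ _ => true), (fun _ _ => true), (fun=> o).
  by rewrite card_unit; split=> // x y _ _; exists tt; split=> // -[].
- exists unit, (fun _ _ => true), (fun _ _ => true), (fun=> o).
  by rewrite card_unit expn_gt0; split=> // x y _ _; exists tt; split=> // -[].
- exists void, (fun _ _ => true), (fun _ _ => true), (fun t : void => match t with end).
  by rewrite card_void; split=> // x y Dx Dy; have := le_n _ _ Dx Dy.
- have [|T1 [a1 [b1 [q1 [c1 h1]]]]] := IH1 n [pred x | DX x && f x] DY.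
    by move=> x y /andP[Dx fx] Dy; have := le_n _ _ Dx Dy; rewrite /= fx.
  have [|T0 [a0 [b0 [q0 [c0 h0]]]]] := IH0 n [pred x | DX x && ~~ f x] DY.
    by move=> x y /andP[Dx /negPf fx] Dy; have := le_n _ _ Dx Dy; rewrite /= fx.
  exists (T1 + T0)%type,
    (fun t x => match t with inl t => f x && a1 t x | inr t => ~~ f x && a0 t x end),
    (fun t y => match t with inl t => b1 t y | inr t => b0 t y end),
    (fun t => match t with inl t => q1 t | inr t => q0 t end).
  split; first by rewrite card_sum expnS mul2n -addnn leq_add.
  move=> x y Dx Dy /=; case fx: (f x).
  - have [|//|t [-> ht]] := h1 x y; first by rewrite /= Dx fx.
    by exists (inl t); split=> // -[t'|t'] //=; rewrite ht.
  - have [|//|t [-> ht]] := h0 x y; first by rewrite /= Dx fx.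
    by exists (inr t); split=> // -[t'|t'] //=; rewrite ht.
- exists void, (fun _ _ => true), (fun _ _ => true), (fun t : void => match t with end).
  by rewrite card_void; split=> // x y Dx Dy; have := le_n _ _ Dx Dy.
- have [|T1 [a1 [b1 [q1 [c1 h1]]]]] := IH1 n DX [pred y | DY y && f y].
    by move=> x y Dx /andP[Dy fy]; have := le_n _ _ Dx Dy; rewrite /= fy.
  have [|T0 [a0 [b0 [q0 [c0 h0]]]]] := IH0 n DX [pred y | DY y && ~~ f y].
    by move=> x y Dx /andP[Dy /negPf fy]; have := le_n _ _ Dx Dy; rewrite /= fy.
  exists (T1 + T0)%type,
    (fun t x => match t with inl t => a1 t x | inr t => a0 t x end),
    (fun t y => match t with inl t => f y && b1 t y | inr t => ~~ f y && b0 t y end),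
    (fun t => match t with inl t => q1 t | inr t => q0 t end).
  split; first by rewrite card_sum expnS mul2n -addnn leq_add.
  move=> x y Dx Dy /=; case fy: (f y).
  - have [//||t [-> ht]] := h1 x y; first by rewrite /= Dy fy.
    by exists (inl t); split=> // -[t'|t'] //=; rewrite ?ht ?andbF.
  - have [//||t [-> ht]] := h0 x y; first by rewrite /= Dy fy.
    by exists (inr t); split=> // -[t'|t'] //=; rewrite ?ht ?andbF.
Qed.

(** * Hellinger distance and the staircase argument *)

Section Hellinger.
Variables (R : realType) (T : finType).
Implicit Types P Q : T -> R.

Lemma sqr_ex (x : R) : 0 <= x -> exists2 y, 0 <= y & x = y ^+ 2.
Proof. by move=> x0; exists (Num.sqrt x); rewrite ?sqrtr_ge0 ?sqr_sqrtr. Qed.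

(** Twice the usual squared Hellinger distance. *)
Definition hell P Q : R := \sum_t (Num.sqrt (P t) - Num.sqrt (Q t)) ^+ 2.

Lemma hellE P Q : (forall t, 0 <= P t) -> (forall t, 0 <= Q t) ->
  hell P Q = \sum_t P t + \sum_t Q t -
    2 * \sum_t Num.sqrt (P t) * Num.sqrt (Q t).
Proof.
move=> P0 Q0; rewrite mulr_sumr -big_split -sumrB; apply: eq_bigr => t _ /=.
by rewrite -{2}(sqr_sqrtr (P0 t)) -{2}(sqr_sqrtr (Q0 t)); ring.
Qed.

(** With [D] the difference of the square roots and [s] their sum,
    [|P - Q| = |D| s <= D^2 + s^2 / 4], and [s^2 / 4 <= (P + Q) / 2] sums to 1. *)
Lemma hell_ge P Q (e : T -> R) : (forall t, 0 <= P t) -> (forall t, 0 <= Q t) ->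
  \sum_t P t = 1 -> \sum_t Q t = 1 -> (forall t, `|e t| <= 1) ->
  \sum_t e t * (P t - Q t) - 1 <= hell P Q.
Proof.
move=> P0 Q0 P1 Q1 e1; rewrite lerBlDr.
have -> : 1 = \sum_t (P t + Q t) / 2 :> R.
  by rewrite -mulr_suml big_split P1 Q1/=; field.
rewrite -big_split; apply: ler_sum => t _ /=.
have [y y0 ->] := sqr_ex (P0 t); have [x x0 ->] := sqr_ex (Q0 t).
rewrite !sqrtr_sqr !ger0_norm//.
apply: (@le_trans _ _ (`|y - x| * (x + y))).
  rewrite (_ : e t * _ = (e t * (y - x)) * (x + y)); last by ring.
  rewrite ler_wpM2r ?addr_ge0//; apply: le_trans (ler_norm _) _.
  by rewrite normrM ler_piMl.
have : 0 <= (`|y - x| - (x + y) / 2) ^+ 2 by exact: sqr_ge0.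
rewrite -[(y - x) ^+ 2]real_normK ?num_real//.
have : `|y - x| ^+ 2 = (y - x) ^+ 2 by rewrite real_normK ?num_real.
move: `|_| => D; nra.
Qed.

(** Pointwise [(y - x)^2 <= (y^2 - x^2)^2 / (y^2 + x^2)] for the square roots, as
    [(x + y)^2 >= x^2 + y^2]. The right-hand side has the form that [level1] controls, with [P] and
    [Q] the leaf laws given the two values of a bit. *)
Lemma hell_le_bias P Q : (forall t, 0 <= P t) -> (forall t, 0 <= Q t) ->
  hell P Q <= 2 * \sum_t ((P t - Q t) / 2) ^+ 2 / ((P t + Q t) / 2).
Proof.
move=> P0 Q0; rewrite mulr_sumr; apply: ler_sum => t _.
have [y y0 ->] := sqr_ex (P0 t); have [x x0 ->] := sqr_ex (Q0 t).
rewrite !sqrtr_sqr !ger0_norm//.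
have [xy|xy] := eqVneq (x + y) 0.
  have [-> ->] : x = 0 /\ y = 0 by lra.
  by rewrite !subrr !mul0r !expr0n/= mul0r mulr0.
have s0 : 0 < x + y by rewrite lt_def xy addr_ge0.
have q0 : 0 < y ^+ 2 + x ^+ 2.
  by have := mulr_gt0 s0 s0; have := sqr_ge0 (x - y); lra.
rewrite mulrA ler_pdivlMr ?divr_gt0//.
have : 0 <= (y - x) ^+ 2 * (x * y).
  by rewrite mulr_ge0 ?sqr_ge0 ?mulr_ge0.
by lra.
Qed.

Lemma hell_telescope (P : nat -> T -> R) (n : nat) :
  hell (P 0) (P n) <= n%:R * \sum_(k < n) hell (P k) (P k.+1).
Proof.
rewrite /hell exchange_big/= mulr_sumr; apply: ler_sum => t _.
pose f k := Num.sqrt (P k t).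
have -> : Num.sqrt (P 0 t) - Num.sqrt (P n t) = \sum_(k < n) (f k - f k.+1).
  elim: n => [|n IH]; first by rewrite big_ord0 subrr.
  by rewrite big_ord_recr/= -IH /f; ring.
(* Cauchy-Schwarz for the telescoping sum, through the sum of squares of pairwise differences. *)
have : 0 <= \sum_(k < n) \sum_(j < n) ((f k - f k.+1) - (f j - f j.+1)) ^+ 2.
  by apply: sumr_ge0 => k _; apply: sumr_ge0 => j _; exact: sqr_ge0.
rewrite (eq_bigr (fun k : 'I_n => n%:R * (f k - f k.+1) ^+ 2 +
   \sum_(j < n) (f j - f j.+1) ^+ 2
   - 2 * (f k - f k.+1) * \sum_(j < n) (f j - f j.+1))); last first.
  move=> k _.
  have -> : n%:R * (f k - f k.+1) ^+ 2 = \sum_(j < n) (f k - f k.+1) ^+ 2.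
    by rewrite sumr_const card_ord mulr_natl.
  rewrite mulr_sumr -big_split -sumrB; apply: eq_bigr => j _ /=; ring.
rewrite !sumrB big_split/= -mulr_sumr sumr_const card_ord.
rewrite -mulr_suml -mulr_sumr -!sumrB -[X in _ + X - _]mulr_natl -/f.
by move: (\sum__ _) (\sum__ _) => x y; lra.
Qed.

(* Cut-and-paste and the Pythagorean property of Hellinger distance. *)
Lemma hell_cut_paste (a0 a1 b0 b1 : T -> R) :
  (forall t, 0 <= a0 t) -> (forall t, 0 <= a1 t) ->
  (forall t, 0 <= b0 t) -> (forall t, 0 <= b1 t) ->
  \sum_t a0 t * b0 t = 1 -> \sum_t a0 t * b1 t = 1 ->
  \sum_t a1 t * b0 t = 1 -> \sum_t a1 t * b1 t = 1 ->
  hell (fun t => a0 t * b0 t) (fun t => a0 t * b1 t) <=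
  2 * hell (fun t => a0 t * b0 t) (fun t => a1 t * b1 t).
Proof.
move=> a00 a10 b00 b10 s00 s01 s10 s11.
have h0 : 0 <= hell (fun t => a1 t * b0 t) (fun t => a1 t * b1 t).
  by apply: sumr_ge0 => t _; exact: sqr_ge0.
apply: (@le_trans _ _ (hell (fun t => a0 t * b0 t) (fun t => a0 t * b1 t) +
   hell (fun t => a1 t * b0 t) (fun t => a1 t * b1 t))); first by rewrite lerDl.
rewrite !hellE => *; rewrite ?mulr_ge0// s00 s01 s10 s11.
suff : 2 * \sum_t Num.sqrt (a0 t * b0 t) * Num.sqrt (a1 t * b1 t) <=
  \sum_t Num.sqrt (a0 t * b0 t) * Num.sqrt (a0 t * b1 t) +
  \sum_t Num.sqrt (a1 t * b0 t) * Num.sqrt (a1 t * b1 t) by lra.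
rewrite mulr_sumr -big_split; apply: ler_sum => t _ /=.
have [x x0 ->] := sqr_ex (b00 t); have [y y0 ->] := sqr_ex (b10 t).
have [z z0 ->] := sqr_ex (a00 t); have [w w0 ->] := sqr_ex (a10 t).
rewrite -!exprMn !sqrtr_sqr !ger0_norm ?mulr_ge0//.
have : 0 <= x * y * (z - w) ^+ 2 by rewrite mulr_ge0 ?sqr_ge0 ?mulr_ge0.
by lra.
Qed.

(** Bob's value increases when leaving an even position and Alice's when leaving an odd one. *)
Definition staircase (B n : nat) : 'I_B.+1 * 'I_B.+1 := (inord n./2, inord (uphalf n)).

(** Cut-and-paste replaces (0,B) by the top (B,B) of the staircase at a factor 2, telescoping over
    the steps costs 2B, and passing to biases another 2. *)
Lemma zigzag (B : nat) (a b : 'I_B.+1 -> T -> R) (e : T -> R)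
   (P := fun w t => a w.1 t * b w.2 t) :
  (0 < B)%N ->
  (forall x t, 0 <= a x t) -> (forall y t, 0 <= b y t) ->
  (forall w, \sum_t P w t = 1) -> (forall t, `|e t| <= 1) ->
  \sum_t e t * (P (ord0, ord0) t - P (ord0, ord_max) t) - 1 <=
  8 * B%:R * \sum_(k < B.*2) \sum_t
    ((P (staircase B k) t - P (staircase B k.+1) t) / 2) ^+ 2 /
    ((P (staircase B k) t + P (staircase B k.+1) t) / 2).
Proof.
move=> B0 a0 b0 P1 e1.
have P0 w t : 0 <= P w t by rewrite mulr_ge0.
apply: le_trans (hell_ge _ _ _ _ e1) _ => //.
apply: (@le_trans _ _ (2 * hell (P (staircase B 0)) (P (staircase B B.*2)))).
  have -> : staircase B 0 = (ord0, ord0).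
    by congr (_, _); apply/val_inj; rewrite /= inordK.
  have -> : staircase B B.*2 = (ord_max, ord_max).
    by rewrite /staircase doubleK uphalf_double; congr (_, _); apply/val_inj; rewrite /= inordK.
  have S i j : \sum_t a i t * b j t = 1 := P1 (i, j).
  exact: (hell_cut_paste (a0 _) (a0 _) (b0 _) (b0 _)).
apply: le_trans (ler_wpM2l _ (hell_telescope (fun k => P (staircase B k)) _)) _ => //.
have -> : B.*2%:R = 2 * B%:R :> R by rewrite -mul2n natrM.
set Y := \sum_(k < B.*2) \sum_t _ / _.
have h : \sum_(k < B.*2) hell (P (staircase B k)) (P (staircase B k.+1)) <= 2 * Y.
  by rewrite mulr_sumr; apply: ler_sum => k _; apply: hell_le_bias.
have B4 : 0 <= 4 * B%:R :> R by rewrite mulr_ge0.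
by have := ler_wpM2l B4 h; lra.
Qed.

End Hellinger.

(** * Laws as push-forwards of uniform averages *)

Section MeanIndicator.
Variable R : realType.

Lemma sum_mean_ind (S T : finType) (h : S -> T) (G : T -> R) :
  \sum_t mean (fun s => (t == h s)%:R) * G t = mean (fun s => G (h s)).
Proof.
rewrite /mean mulr_suml (eq_bigr (fun t => \sum_s (t == h s)%:R * G t / #|S|%:R)).
  rewrite exchange_big; apply: eq_bigr => s _ /=.
  rewrite (bigD1 (h s))//= eqxx mul1r big1 ?addr0// => t /negPf ->.
  by rewrite !mul0r.
by move=> t _; rewrite mulr_suml mulr_suml; apply: eq_bigr => s _; rewrite mulrAC.
Qed.

Lemma unif_imset (S T : finType) (h : S -> T) (A : {set T}) (t : T) :
  injective h -> A = [set h s | s : S] ->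
  unif R A t = mean (fun s => (t == h s)%:R).
Proof.
move=> hI ->; rewrite /unif card_imset// /mean; congr (_ / _).
have [/imsetP[s _ ->]|tA] := boolP (t \in _).
  rewrite (bigD1 s)//= eqxx big1 ?addr0// => s' ss'.
  by rewrite (inj_eq hI) eq_sym (negPf ss').
rewrite big1// => s _; case: eqP tA => // ->.
by rewrite imset_f.
Qed.

Lemma prod_mean (I A : finType) (F : I -> A -> R) :
  \prod_i mean (F i) = mean (fun f : {ffun I -> A} => \prod_i F i (f i)).
Proof.
by rewrite big_split/= bigA_distr_bigA/= prodr_const exprVn /mean card_ffun natrX.
Qed.

Lemma prod_bool (I : finType) (b : I -> bool) :
  \prod_i (b i)%:R = [forall i, b i]%:R :> R.
Proof.
have [/forallP h|/forallPn[i /negPf h]] := boolP [forall i, b i].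
  by rewrite big1// => i _; rewrite h.
by rewrite (bigD1 i)//= h mul0r.
Qed.

End MeanIndicator.

(** * Sampling [sigma] from step numbers, bits and planted data *)

Section Law.
Variables (R : realType) (r B m : nat).

(** The pair (z,0) gets number 2z and (z,1) gets 2z - 1; the two excluded pairs (0,1) and (B,0)
    would be numbers -1 and 2B. *)
Definition step_ZP (k : 'I_B.*2) : 'I_B.+1 * bool := (inord (uphalf k), odd k).

Lemma step_ZP_inj : injective step_ZP.
Proof.
move=> k l [/(congr1 val)/=]; have := ltn_ord k; have := ltn_ord l => lB kB.
rewrite !inordK; [|lia..] => h1 h2; apply/val_inj => /=; lia.
Qed.

Lemma ZP_rangeE : ZP_range B = [set step_ZP k | k : 'I_B.*2].
Proof.
apply/setP => -[z p]; apply/idP/imsetP.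
  rewrite !inE !xpair_eqE => /andP[].
  rewrite -!(inj_eq val_inj) /= => zB z0; have := ltn_ord z => zl.
  have kl : ((z : nat).*2 - p < B.*2)%N by case: p zB z0 => /=; lia.
  exists (Ordinal kl) => //; congr (_, _); last by case: p zB z0 kl => /=; lia.
  by apply/val_inj; rewrite /= inordK; case: p zB z0 kl => /=; lia.
move=> [k _ [-> ->]]; have := ltn_ord k => kB.
rewrite !inE !xpair_eqE -!(inj_eq val_inj) /= inordK; last lia.
lia.
Qed.

(** The bound on [n] keeps both calls of [inord] away from their default value. *)
Lemma staircase_eq n (w : 'I_B.+1 * 'I_B.+1) : (n <= B.*2)%N ->
  (w == staircase B n) = (w.1 == n./2 :> nat) && (w.2 == uphalf n :> nat).
Proof.
move=> nB; case: w => x y; rewrite xpair_eqE -!(inj_eq val_inj) /= !inordK//; lia.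
Qed.

Lemma XY_rangeE (k : 'I_B.*2) :
  XY_range (step_ZP k) = [set staircase B (k + u) | u : bool].
Proof.
have kB := ltn_ord k.
apply/setP => -[x y]; have yB := ltn_ord y; have xB := ltn_ord x.
rewrite /XY_range /= (_ : (_ \in [set _ | _ : bool]) =
  ((x, y) == staircase B k) || ((x, y) == staircase B k.+1)); last first.
  apply/imsetP/orP => [[[] _ ->]|[/eqP->|/eqP->]].
  - by right; rewrite addn1.
  - by left; rewrite addn0.
  - by exists false; rewrite ?addn0.
  - by exists true; rewrite ?addn1.
rewrite !staircase_eq//=; [|lia..].
by case: ifP => ok; rewrite !inE/= -!(inj_eq val_inj) /= inordK; lia.
Qed.

Lemma staircase_step_inj (k : 'I_B.*2) :
  injective (fun u : bool => staircase B (k + u)).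
Proof.
have kB := ltn_ord k.
move=> u v /eqP; rewrite staircase_eq; last by case: v; lia.
by rewrite /= !inordK; case: u; case: v => //=; lia.
Qed.

Lemma coord_lawE w : coord_law R w =
  mean (fun k : 'I_B.*2 => mean (fun u : bool => (w == staircase B (k + u))%:R)).
Proof.
rewrite /coord_law.
under eq_bigr do rewrite (unif_imset _ _ step_ZP_inj ZP_rangeE).
rewrite sum_mean_ind; apply: eq_mean => k.
exact: unif_imset (@staircase_step_inj k) (XY_rangeE k).
Qed.

Definition walk1 (k : {ffun 'I_m -> 'I_B.*2}) (u : {ffun 'I_m -> bool}) :
    vec B m * vec B m :=
  ([ffun j => (staircase B (k j + u j)).1], [ffun j => (staircase B (k j + u j)).2]).

Definition planted_value (v : bool) : 'I_B.+1 := if v then ord_max else ord0.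

Definition sample1 (w : {ffun 'I_m -> 'I_B.*2} * {ffun 'I_m -> bool} * 'I_m * bool) :=
  (replace (walk1 w.1.1.1 w.1.1.2).1 w.1.2 ord0,
   replace (walk1 w.1.1.1 w.1.1.2).2 w.1.2 (planted_value w.2)).

Hypothesis B_gt0 : (0 < B)%N.

Lemma sigmaE xy : sigma R xy = mean (fun w => (xy == sample1 w)%:R).
Proof.
rewrite /sigma.
have E1 (xy0 : vec B m * vec B m) : \prod_(j < m) coord_law R (xy0.1 j, xy0.2 j) =
    mean (fun w : _ * _ => (xy0 == walk1 w.1 w.2)%:R).
  under eq_bigr do rewrite coord_lawE.
  rewrite prod_mean mean_pair; apply: eq_mean => k /=.
  rewrite prod_mean; apply: eq_mean => u.
  rewrite prod_bool; congr (nat_of_bool _)%:R.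
  apply/forallP/eqP => [h|-> j]; last by rewrite !ffunE -surjective_pairing.
  rewrite [LHS]surjective_pairing; congr (_, _); apply/ffunP => j;
  by have /eqP := h j; rewrite !ffunE; case: staircase => ? ? [].
have E2 ab : unif R (planted B) ab =
    mean (fun v => (ab == (ord0, planted_value v))%:R).
  apply: unif_imset => [[] [] // []//|]; try by case: B B_gt0.
  apply/setP => -[x y]; rewrite !inE; apply/orP/imsetP => [[]/eqP ->|[[] _ ->]].
  - by exists false.
  - by exists true.
  - by right.
  - by left.
have E3 s : unif R [set: 'I_m] s = mean (fun s' => (s == s')%:R).
  by apply: unif_imset => //; apply/setP => j; rewrite inE; apply/esym/imsetP; exists j.
rewrite (eq_bigr (fun xy0 : vec B m * vec B m =>
    mean (fun w : _ * _ => (xy0 == walk1 w.1 w.2)%:R) *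
    \sum_s mean (fun s' => (s == s')%:R) *
    \sum_ab mean (fun v => (ab == (ord0, planted_value v))%:R) *
      (xy == (replace xy0.1 s ab.1, replace xy0.2 s ab.2))%:R)).
  rewrite sum_mean_ind [RHS]mean_pair [RHS]mean_pair; apply: eq_mean => -[k u].
  rewrite sum_mean_ind; apply: eq_mean => s.
  by rewrite sum_mean_ind.
move=> xy0 _; rewrite mulr_sumr; apply: eq_bigr => s _.
rewrite !mulr_sumr; apply: eq_bigr => ab _.
by rewrite E1 E2 E3 !mulrA.
Qed.

(** One table for the coordinates of all copies, so that all the bits form a single cube. *)
Definition cells := {ffun 'I_r * 'I_m -> 'I_B.+1 * 'I_B.+1}.

Definition alice (W : cells) : vecs r B m := [ffun i => [ffun j => (W (i, j)).1]].
Definition bob (W : cells) : vecs r B m := [ffun i => [ffun j => (W (i, j)).2]].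

Definition walk (k : {ffun 'I_r * 'I_m -> 'I_B.*2}) (u : {ffun 'I_r * 'I_m -> bool})
  : cells := [ffun c => staircase B (k c + u c)].

Definition plant (s : {ffun 'I_r -> 'I_m}) (v : {ffun 'I_r -> bool}) (W : cells)
  : cells := [ffun c => if c.2 == s c.1 then (ord0, planted_value (v c.1)) else W c].

(** Regroups the randomness by kind instead of by copy, so that one kind can be averaged while the
    others stay fixed. *)
Lemma sigma_powE (F : vecs r B m * vecs r B m -> R) :
  \sum_w sigma_pow R w * F w =
  mean (fun k => mean (fun u => mean (fun s => mean (fun v =>
    F (alice (plant s v (walk k u)), bob (plant s v (walk k u))))))).
Proof.
pose O1 := ({ffun 'I_m -> 'I_B.*2} * {ffun 'I_m -> bool} * 'I_m * bool)%type.
pose vals (f : {ffun 'I_r -> O1}) : vecs r B m * vecs r B m :=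
  ([ffun i => (sample1 (f i)).1], [ffun i => (sample1 (f i)).2]).
rewrite (eq_bigr (fun w => mean (fun f => (w == vals f)%:R) * F w)); last first.
  move=> [x y] _; congr (_ * _); rewrite /sigma_pow.
  under eq_bigr do rewrite sigmaE.
  rewrite prod_mean; apply: eq_mean => f; rewrite prod_bool; congr (nat_of_bool _)%:R.
  apply/forallP/eqP => [h|[-> ->] i]; last by apply/eqP; rewrite /= !ffunE.
  by congr (_, _); apply/ffunP => i; have /eqP hi := h i; rewrite ffunE -hi.
rewrite sum_mean_ind.
pose h (q : {ffun 'I_r * 'I_m -> 'I_B.*2} * {ffun 'I_r * 'I_m -> bool} *
    {ffun 'I_r -> 'I_m} * {ffun 'I_r -> bool}) : {ffun 'I_r -> O1} :=
  [ffun i => ([ffun j => q.1.1.1 (i, j)], [ffun j => q.1.1.2 (i, j)], q.1.2 i, q.2 i)].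
have bh : bijective h.
  exists (fun f : {ffun 'I_r -> O1} => ([ffun c : 'I_r * 'I_m => (f c.1).1.1.1 c.2],
    [ffun c : 'I_r * 'I_m => (f c.1).1.1.2 c.2], [ffun i => (f i).1.2], [ffun i => (f i).2])).
    move=> [[[k u] s] v]; rewrite /h/=; congr (_, _, _, _);
    by apply/ffunP => -[i j] || apply/ffunP => i; rewrite !ffunE/= ?ffunE.
  move=> f; apply/ffunP => i; rewrite !ffunE /=.
  case E : (f i) => [[[k u] s] v] /=; congr (_, _, _, _) => //;
  by apply/ffunP => j; rewrite !ffunE /= E.
rewrite (mean_reindex _ bh) !mean_pair; apply: eq_mean => k.
apply: eq_mean => u; apply: eq_mean => s; apply: eq_mean => v /=; congr (F (_, _));
  apply/ffunP => i; apply/ffunP => j; rewrite !ffunE /= ?ffunE;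
  by case: eqP; rewrite /= ?ffunE.
Qed.

End Law.

(** * The cost of planting an extra (0,0) *)

Section Resample.
Variables (R : realType) (r B m : nat).
Hypothesis B_gt0 : (0 < B)%N.
Notation K := {ffun 'I_r * 'I_m -> 'I_B.*2}.
Notation U := {ffun 'I_r * 'I_m -> bool}.
Implicit Types (k : K) (u : U) (c : 'I_r * 'I_m).

Lemma steps_gt0 : (0 < B.*2)%N.
Proof. by rewrite double_gt0. Qed.

Lemma card_steps : (0 < #|'I_B.*2|)%N.
Proof. by rewrite card_ord double_gt0. Qed.

Lemma resample_ku c (F : K -> U -> R) :
  mean (fun k => mean (F k)) =
  mean (fun k => mean (fun u => mean (fun x => mean (fun y =>
    F (upd k c x) (upd u c y))))).
Proof.
rewrite (mean_resample c _ card_steps); apply: eq_mean => k.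
rewrite [RHS]exchange_mean; apply: eq_mean => x.
by rewrite (mean_resample c)// card_bool.
Qed.

Lemma walk_upd k u c x y :
  walk (upd k c x) (upd u c y) = upd (walk k u) c (staircase B (x + y)).
Proof. by apply/ffunP => d; rewrite !ffunE; case: eqP. Qed.

Lemma staircase0 : staircase B 0 = (ord0, ord0).
Proof. by congr (_, _); apply/val_inj; rewrite /= inordK. Qed.

(* A uniform step is taken at its end (0, 0) with probability 1 / (4 B). *)
Definition zero_density (x : 'I_B.*2) (y : bool) : R :=
  ((x == 0 :> nat) && ~~ y)%:R * (4 * B%:R).

Lemma mean_zero_density (g : 'I_B.*2 -> bool -> R) :
  mean (fun x => mean (fun y => zero_density x y * g x y)) =
  g (Ordinal steps_gt0) false.
Proof.
have B0 : B%:R != 0 :> R by rewrite pnatr_eq0 -lt0n.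
under eq_mean do rewrite mean_bool.
rewrite /mean card_ord (bigD1 (Ordinal steps_gt0))//= big1 => [|x x0].
  rewrite /zero_density /= (_ : B.*2%:R = 2 * B%:R); first by field.
  by rewrite -mul2n natrM.
rewrite /zero_density -[_ == 0%N]/(x == Ordinal steps_gt0) (negPf x0) !mul0r.
by rewrite addr0 mul0r.
Qed.

(** A change of measure: resampling cell [c] shows that forcing it to (0,0) amounts to weighting by
    the density. *)
Lemma mean_at_zero c (G : cells r B m -> R) :
  mean (fun k => mean (fun u => G (upd (walk k u) c (ord0, ord0)))) =
  mean (fun k => mean (fun u => zero_density (k c) (u c) * G (walk k u))).
Proof.
rewrite (resample_ku c (fun k u => _ * _)); apply: eq_mean => k; apply: eq_mean => u.
under [RHS]eq_mean do under eq_mean do rewrite !upd_id walk_upd.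
by rewrite mean_zero_density /= addn0 staircase0.
Qed.

Lemma card_bits : (0 < #|U|)%N.
Proof. by rewrite card_ffun card_bool expn_gt0. Qed.

Lemma card_walks : (0 < #|K|)%N.
Proof. by rewrite card_ffun expn_gt0 card_steps. Qed.

(** The centred densities of distinct cells are uncorrelated. A single density equals 4B with
    probability 1/(4B) and 0 otherwise, so its variance is 4B - 1. *)
Lemma density_variance (i : 'I_r) :
  mean (fun k : K => mean (fun u : U =>
    (\sum_j (zero_density (k (i, j)) (u (i, j)) - 1)) ^+ 2)) =
  m%:R * (4 * B%:R - 1).
Proof.
pose z k u j : R := zero_density (k (i, j)) (u (i, j)) - 1.
have m1 : mean (fun x => mean (fun y => zero_density x y - 1)) = 0.
  rewrite (eq_mean (G := fun x => mean (fun y => zero_density x y * 1) - 1)).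
    by rewrite meanB mean_zero_density mean_cst ?card_steps// subrr.
  by move=> x; rewrite meanB mean_cst ?card_bool// (eq_mean (fun y => mulr1 _)).
have m2 : mean (fun x => mean (fun y => (zero_density x y - 1) ^+ 2)) = 4 * B%:R - 1.
  rewrite (eq_mean (G := fun x => mean (fun y =>
     zero_density x y * (zero_density x y - 2)) + 1)).
    rewrite meanD mean_zero_density mean_cst ?card_steps//.
    by rewrite /zero_density/=; ring.
  move=> x; rewrite -[X in _ + X](@mean_cst _ bool) ?card_bool// -meanD.
  by apply: eq_mean => y; ring.
have zz j j' : mean (fun k => mean (fun u => z k u j * z k u j')) =
    (j == j')%:R * (4 * B%:R - 1).
  rewrite (resample_ku (i, j) (fun k u => _ * _)).
  have [<-|jj'] := eqVneq j j'.
    rewrite mul1r -[RHS](@mean_cst _ K) ?card_walks//; apply: eq_mean => k.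
    rewrite -[RHS](@mean_cst _ U) ?card_bits//; apply: eq_mean => u.
    by rewrite -m2; apply: eq_mean => x; apply: eq_mean => y; rewrite /z !upd_id.
  rewrite mul0r -[RHS](@mean_cst _ K) ?card_walks//; apply: eq_mean => k.
  rewrite -[RHS](@mean_cst _ U) ?card_bits//; apply: eq_mean => u.
  rewrite -[RHS](mulr0 (z k u j')) -m1 -meanZ; apply: eq_mean => x.
  rewrite -meanZ; apply: eq_mean => y; rewrite /z !upd_id mulrC.
  have jj : (i, j') != (i, j) by rewrite xpair_eqE eqxx eq_sym.
  by rewrite !upd_neq.
transitivity (mean (fun k => mean (fun u => \sum_j \sum_j' z k u j * z k u j'))).
  apply: eq_mean => k; apply: eq_mean => u; rewrite expr2 mulr_suml.
  by apply: eq_bigr => j _; rewrite mulr_sumr.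
under eq_mean => k do rewrite mean_sum.
rewrite mean_sum (eq_bigr (fun=> 4 * B%:R - 1)); last first.
  move=> j _; under eq_mean => k do rewrite mean_sum.
  rewrite mean_sum (bigD1 j)//= zz eqxx mul1r big1 ?addr0// => j' jj'.
  by rewrite zz eq_sym (negPf jj') mul0r.
by rewrite sumr_const card_ord [RHS]mulr_natl.
Qed.

(* The density of the planted law is the average of [zero_density] over the copy,
   which concentrates around 1 by the second moment method. *)
Lemma plant_zero (i : 'I_r) (G : cells r B m -> R) (eta : R) :
  (forall W, 0 <= G W <= 1) -> 0 < eta -> (0 < m)%N ->
  4 * B%:R <= eta ^+ 2 * m%:R ->
  mean (fun j => mean (fun k => mean (fun u =>
    G (upd (walk k u) (i, j) (ord0, ord0))))) <=
  mean (fun k => mean (fun u => G (walk k u))) + eta.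
Proof.
move=> G01 eta0 m0 etam.
have m0' : 0 < m%:R :> R by rewrite ltr0n.
have mn := lt0r_neq0 m0'; have en := lt0r_neq0 eta0.
pose Z k u : R := \sum_j (zero_density (k (i, j)) (u (i, j)) - 1).
have step : mean (fun k => mean (fun u => Z k u * G (walk k u))) <= eta * m%:R.
  (* Young's inequality [|Z| <= Z^2 / (2 y) + y / 2] with [y = eta m] reduces the first moment to
     the variance. *)
  apply: (@le_trans _ _ (mean (fun k => mean (fun u =>
      (2 * (eta * m%:R))^-1 * Z k u ^+ 2 + eta * m%:R / 2)))).
    apply: le_mean => k; apply: le_mean => u.
    have /andP[g0 g1] := G01 (walk k u).
    have em : 0 < eta * m%:R by rewrite mulr_gt0.
    apply: (@le_trans _ _ `|Z k u|).
      apply: le_trans (ler_norm _) _.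
      by rewrite normrM (ger0_norm g0) ler_piMr.
    rewrite -(real_normK (num_real (Z k u))).
    move: `|Z k u| (eta * m%:R) em => x y y0.
    rewrite (_ : _ + _ = (x ^+ 2 + y ^+ 2) / (2 * y)); last first.
      by field; rewrite gt_eqF.
    by rewrite ler_pdivlMr ?mulr_gt0//; have := sqr_ge0 (x - y); lra.
  rewrite (eq_mean (G := fun k => (2 * (eta * m%:R))^-1 *
     mean (fun u => Z k u ^+ 2) + eta * m%:R / 2)); last first.
    by move=> k; rewrite meanD [X in X + _]meanZ mean_cst ?card_bits.
  rewrite meanD [X in X + _]meanZ mean_cst ?card_walks// density_variance.
  rewrite (_ : _ * _ = (4 * B%:R - 1) / (2 * eta)); last first.
    by field; rewrite mn en.
  suff : (4 * B%:R - 1) / (2 * eta) <= eta * m%:R / 2 by lra.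
  by rewrite ler_pdivrMr ?mulr_gt0//; lra.
under eq_mean do rewrite mean_at_zero.
rewrite exchange_mean.
under eq_mean do rewrite exchange_mean.
rewrite -lerBlDl -meanB.
under eq_mean do rewrite -meanB.
have -> : eta = m%:R^-1 * (eta * m%:R) by field; rewrite gt_eqF.
apply: le_trans (ler_wpM2l _ step); last by rewrite invr_ge0.
rewrite -meanZ le_eqVlt; apply/orP; left; apply/eqP; apply: eq_mean => k.
rewrite -meanZ; apply: eq_mean => u.
rewrite /Z sumrB sumr_const card_ord /mean -mulr_suml card_ord.
by field; rewrite gt_eqF.
Qed.

End Resample.

(** * Biases of the bits given the leaf, and the errors of the answers *)

Section Protocol.
Variables (R : realType) (r B m : nat) (T : finType).
Variables (a b : T -> vecs r B m -> bool) (out : T -> {ffun 'I_r -> bool}).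
Hypothesis B_gt0 : (0 < B)%N.
Notation K := {ffun 'I_r * 'I_m -> 'I_B.*2}.
Notation U := {ffun 'I_r * 'I_m -> bool}.
Notation S := {ffun 'I_r -> 'I_m}.
Notation V := {ffun 'I_r -> bool}.
Implicit Types (W : cells r B m) (k : K) (u : U) (s : S) (v : V) (c : 'I_r * 'I_m).

Definition reach (t : T) (x y : vecs r B m) : R := (a t x && b t y)%:R.

Hypothesis reach_sum : forall x y, \sum_t reach t x y = 1.

Definition leaf t W := reach t (alice W) (bob W).

Lemma leaf_ge0 t W : 0 <= leaf t W. Proof. exact: ler0n. Qed.

Lemma leaf_sum W : \sum_t leaf t W = 1. Proof. exact: reach_sum. Qed.

Definition err (i : 'I_r) (z : bool) W : R := \sum_t leaf t W * (out t i != z)%:R.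

Lemma err_ge0 i z W : 0 <= err i z W.
Proof. by apply: sumr_ge0 => t _; rewrite mulr_ge0 ?leaf_ge0. Qed.

Lemma err_le1 i z W : err i z W <= 1.
Proof.
rewrite -(leaf_sum W); apply: ler_sum => t _.
by rewrite ler_piMr ?leaf_ge0// lern1 leq_b1.
Qed.

(** The squared conditional bias of the bit at [c] given the leaf, averaged over leaves: one summand
    of the level-1 inequality. *)
Definition info (s : S) (v : V) (k : K) c : R :=
  \sum_t mean (fun u => leaf t (plant s v (walk k u)) * chi R (u c)) ^+ 2 /
         mean (fun u => leaf t (plant s v (walk k u))).

Lemma info_ge0 s v k c : 0 <= info s v k c.
Proof.
apply: sumr_ge0 => t _; apply: divr_ge0; first exact: sqr_ge0.
by apply: mean_ge0 => u; exact: leaf_ge0.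
Qed.

Lemma alice_upd c x y y' W : alice (upd W c (x, y)) = alice (upd W c (x, y')).
Proof. by apply/ffunP => i; apply/ffunP => j; rewrite !ffunE; case: eqP. Qed.

Lemma bob_upd c x x' y W : bob (upd W c (x, y)) = bob (upd W c (x', y)).
Proof. by apply/ffunP => i; apply/ffunP => j; rewrite !ffunE; case: eqP. Qed.

Lemma plant_upd s v c x W : c.2 != s c.1 ->
  plant s v (upd W c x) = upd (plant s v W) c x.
Proof.
move=> cs; apply/ffunP => d; rewrite !ffunE.
by case: (eqVneq d c) => [->|//]; rewrite (negPf cs).
Qed.

(* Given the steps [k], only odd steps move Alice and only even ones Bob, so
   the probability of a leaf is a product. *)
Lemma leaf_product s v k c (w : 'I_B.+1 * 'I_B.+1) t :
  mean (fun u => leaf t (upd (plant s v (walk k u)) c w)) =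
  mean (fun u => (a t (alice (upd (plant s v (walk k u)) c (w.1, ord0))))%:R) *
  mean (fun u => (b t (bob (upd (plant s v (walk k u)) c (ord0, w.2))))%:R).
Proof.
rewrite -[RHS](@mean_indep R _ bool [pred d | odd (k d)]
  (fun u => (a t (alice (upd (plant s v (walk k u)) c (w.1, ord0))))%:R)
  (fun u => (b t (bob (upd (plant s v (walk k u)) c (ord0, w.2))))%:R)).
- apply: eq_mean => u; rewrite /leaf /reach -mulnb natrM; case: w => x y.
  by rewrite (alice_upd _ _ y ord0) (bob_upd _ x ord0).
- by rewrite card_bool.
- move=> f g fg; congr (nat_of_bool (a t _))%:R.
  apply/ffunP => i; apply/ffunP => j; rewrite !ffunE; case: eqP => // _.
  case: eqP => // _ /=.
  have [ok|ok] := boolP (odd (k (i, j))); first by rewrite fg.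
  by congr (inord _); case: (f _); case: (g _); rewrite ?addn0 ?addn1//; lia.
- move=> f g fg; congr (nat_of_bool (b t _))%:R.
  apply/ffunP => i; apply/ffunP => j; rewrite !ffunE; case: eqP => // _.
  case: eqP => // _ /=.
  have [ok|ok] := boolP (odd (k (i, j))); last by rewrite fg.
  congr (inord _); case: (f _); case: (g _); rewrite ?addn0 ?addn1//.
    by rewrite !uphalf_half /= ok uphalf_half ok.
  by rewrite !uphalf_half /= ok uphalf_half ok.
Qed.

(** [zigzag] applies to the leaf laws with cell [c] set by hand, since these factor by
    [leaf_product]. The test is the sign of the answer on the copy of [c]; its advantage is 2 minus
    twice both errors. *)
Lemma info_coord (s : S) (v : V) (k : K) (c : 'I_r * 'I_m) : c.2 != s c.1 ->
  1 - 2 * mean (fun u => err c.1 false (upd (plant s v (walk k u)) c (ord0, ord0)))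
    - 2 * mean (fun u => err c.1 true (upd (plant s v (walk k u)) c (ord0, ord_max)))
  <= 16 * B%:R ^+ 2 * mean (fun x => info s v (upd k c x) c).
Proof.
move=> cs.
pose P (w : 'I_B.+1 * 'I_B.+1) t :=
  mean (fun u => leaf t (upd (plant s v (walk k u)) c w)).
pose al x t : R :=
  mean (fun u => (a t (alice (upd (plant s v (walk k u)) c (x, ord0))))%:R).
pose be y t : R :=
  mean (fun u => (b t (bob (upd (plant s v (walk k u)) c (ord0, y))))%:R).
pose e t : R := if out t c.1 then -1 else 1.
have PE w t : P w t = al w.1 t * be w.2 t by exact: leaf_product.
have P1 w : \sum_t P w t = 1.
  rewrite -mean_sum (eq_mean (G := fun=> 1)); first by rewrite mean_cst ?card_bits.
  by move=> u; rewrite leaf_sum.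
(* With step number [x] at [c], the two values of the bit put the cell at the two ends of that
   step. *)
have infoE (x : 'I_B.*2) : info s v (upd k c x) c =
   \sum_t ((P (staircase B x) t - P (staircase B x.+1) t) / 2) ^+ 2 /
     ((P (staircase B x) t + P (staircase B x.+1) t) / 2).
  apply: eq_bigr => t _; congr (_ ^+ 2 / _).
    rewrite (mean_resample c) ?card_bool// /P -meanB mulrC -meanZ.
    apply: eq_mean => u; rewrite mean_bool !walk_upd !plant_upd// !upd_id /chi.
    by rewrite addn1 addn0; field.
  rewrite (mean_resample c) ?card_bool// /P -meanD mulrC -meanZ.
  apply: eq_mean => u; rewrite mean_bool !walk_upd !plant_upd//.
  by rewrite addn1 addn0; field.
(* The mean runs over 2B steps, so the factor 8B of [zigzag] becomes 16 B^2. *)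
have -> : 16 * B%:R ^+ 2 * mean (fun x => info s v (upd k c x) c) =
   8 * B%:R * \sum_(x < B.*2) info s v (upd k c x) c.
  have B0 : B%:R != 0 :> R by rewrite pnatr_eq0 -lt0n.
  rewrite /mean card_ord (_ : B.*2%:R = 2 * B%:R); first by field.
  by rewrite -mul2n natrM.
have := @zigzag R T B al be e B_gt0.
have -> : \sum_t e t * (al (ord0, ord0).1 t * be (ord0, ord0).2 t -
    al (ord0, ord_max).1 t * be (ord0, ord_max).2 t) - 1 =
  1 - 2 * mean (fun u => err c.1 false (upd (plant s v (walk k u)) c (ord0, ord0)))
    - 2 * mean (fun u => err c.1 true (upd (plant s v (walk k u)) c (ord0, ord_max))).
  rewrite !mean_sum.
  transitivity (\sum_t ((P (ord0, ord0) t - 2 * mean (fun u =>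
     leaf t (upd (plant s v (walk k u)) c (ord0, ord0)) * (out t c.1 != false)%:R))
    + (P (ord0, ord_max) t - 2 * mean (fun u =>
     leaf t (upd (plant s v (walk k u)) c (ord0, ord_max)) *
     (out t c.1 != true)%:R))) - 1); last first.
    by rewrite big_split /= !sumrB !P1 -!mulr_sumr; ring.
  congr (_ - 1); apply: eq_bigr => t _.
  rewrite -(PE (ord0, ord0)) -(PE (ord0, ord_max)) /e.
  under [X in _ = _ - 2 * X + _]eq_mean do rewrite mulrC.
  under [X in _ = _ + (_ - 2 * X)]eq_mean do rewrite mulrC.
  by rewrite !meanZ -/(P _ t) -/(P _ t); case: (out t c.1) => /=; ring.
move=> h; apply: le_trans (h _ _ _ _) _.
- by move=> x t; apply: mean_ge0 => u; exact: ler0n.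
- by move=> x t; apply: mean_ge0 => u; exact: ler0n.
- by move=> w; rewrite -(P1 w); apply: eq_bigr => t _; rewrite PE.
- by move=> t; rewrite /e; case: ifP; rewrite ?normrN normr1.
rewrite le_eqVlt; apply/orP; left; apply/eqP; congr (_ * _); apply: eq_bigr => x _.
by rewrite infoE; apply: eq_bigr => t _; rewrite !PE.
Qed.

(** Leaves copy [i] untouched, so that its planted cell can be placed separately. *)
Definition plant_others (i : 'I_r) (s : S) (v : V) W : cells r B m :=
  [ffun c => if (c.1 != i) && (c.2 == s c.1)
             then (ord0, planted_value B (v c.1)) else W c].

Lemma plant_updE i s v j z W :
  plant (upd s i j) (upd v i z) W =
  upd (plant_others i s v W) (i, j) (ord0, planted_value B z).
Proof.
apply/ffunP => -[i' j']; rewrite !ffunE xpair_eqE /=.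
by case: (eqVneq i' i).
Qed.

Lemma plant_others_upd i s v j x W :
  plant_others i s v (upd W (i, j) x) = upd (plant_others i s v W) (i, j) x.
Proof.
apply/ffunP => -[i' j']; rewrite !ffunE xpair_eqE /=.
by case: (eqVneq i' i).
Qed.

Definition err_given (i : 'I_r) (z : bool) : R :=
  mean (fun s => mean (fun v => mean (fun k => mean (fun u =>
    err i z (plant s (upd v i z) (walk k u)))))).

Lemma err_given_mean i :
  mean (fun s => mean (fun v => mean (fun k => mean (fun u =>
    err i (v i) (plant s v (walk k u)))))) =
  (err_given i true + err_given i false) / 2.
Proof.
rewrite /err_given -meanD mulrC -meanZ; apply: eq_mean => s.
rewrite (mean_resample i) ?card_bool// -meanD -meanZ; apply: eq_mean => v.
by rewrite mean_bool !upd_id mulrC.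
Qed.

Lemma err_givenE i z : (0 < m)%N -> err_given i z =
  mean (fun s => mean (fun v => mean (fun j => mean (fun k => mean (fun u =>
    err i z (upd (plant_others i s v (walk k u)) (i, j) (ord0, planted_value B z))))))).
Proof.
move=> m0; rewrite /err_given (mean_resample i) ?card_ord//.
apply: eq_mean => s; rewrite exchange_mean; apply: eq_mean => v.
apply: eq_mean => j; apply: eq_mean => k; apply: eq_mean => u.
by rewrite plant_updE.
Qed.

(** The two plantings in copy [i] trade roles: [j] becomes the genuine planted place with answer
    [z], and the (0,0) at the uniform place [s i] becomes the extra one, paid for by
    [plant_zero]. *)
Lemma err_double_plant i z eta : (0 < m)%N -> 0 < eta ->
  4 * B%:R <= eta ^+ 2 * m%:R ->
  \sum_j mean (fun s : S => mean (fun v : V => mean (fun k : K => mean (fun u : U =>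
    (s i != j)%:R * err i z (upd (plant s (upd v i false) (walk k u)) (i, j)
                              (ord0, planted_value B z)))))) <=
  m%:R * (err_given i z + eta).
Proof.
move=> m0 eta0 etam.
pose G s v j W :=
  err i z (upd (plant_others i s v W) (i, j) (ord0, planted_value B z)).
pose H s v j := mean (fun k : K => mean (fun u : U => G s v j (walk k u))).
have cardV : (0 < #|V|)%N by rewrite card_ffun card_bool expn_gt0.
have cardS : (0 < #|S|)%N by rewrite card_ffun card_ord expn_gt0 m0.
apply: (@le_trans _ _ (\sum_j (mean (fun s => mean (fun v => H s v j)) + eta))).
  apply: ler_sum => j _; rewrite (mean_resample i) ?card_ord//.
  rewrite -[X in _ + X](@mean_cst _ S)// -meanD; apply: le_mean => s.
  rewrite exchange_mean -[X in _ + X](@mean_cst _ V)// -meanD; apply: le_mean => v.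
  apply: le_trans (plant_zero B_gt0 i (G := G s v j) _ eta0 m0 etam) => //.
    apply: le_mean => j'; apply: le_mean => k; apply: le_mean => u.
    rewrite upd_id plant_updE /G plant_others_upd.
    by case: eqP => _; rewrite ?mul0r ?mul1r ?err_ge0.
  by move=> W; rewrite err_ge0 err_le1.
rewrite big_split/= sumr_const card_ord mulrDr -[_ *+ m]mulr_natl lerD2r.
rewrite err_givenE// -/(H _ _ _) -mean_sum -meanZ.
rewrite le_eqVlt; apply/orP; left; apply/eqP; apply: eq_mean => s.
rewrite -mean_sum -meanZ; apply: eq_mean => v.
by rewrite /mean card_ord mulrCA mulfV ?mulr1// pnatr_eq0 -lt0n.
Qed.

(** Sums [info_coord] over the cells of copy [i] other than the planted one, whence [m - 1], with
    the answer of the copy set to NO. *)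
Lemma info_copy (i : 'I_r) (eta : R) : (0 < m)%N -> 0 < eta ->
  4 * B%:R <= eta ^+ 2 * m%:R ->
  m%:R - 1 - 2 * m%:R * (err_given i true + err_given i false + 2 * eta) <=
  32 * B%:R ^+ 2 *
    \sum_j mean (fun s => mean (fun v => mean (fun k => info s v k (i, j)))).
Proof.
move=> m0 eta0 etam.
have cardV : (0 < #|V|)%N by rewrite card_ffun card_bool expn_gt0.
have cardS : (0 < #|S|)%N by rewrite card_ffun card_ord expn_gt0 m0.
pose E z s v j k : R := mean (fun u : U =>
  err i z (upd (plant s (upd v i false) (walk k u)) (i, j) (ord0, planted_value B z))).
have coord j : mean (fun s : S => mean (fun v : V => mean (fun k : K =>
    (s i != j)%:R * (1 - 2 * E false s v j k - 2 * E true s v j k)))) <=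
    32 * B%:R ^+ 2 * mean (fun s => mean (fun v => mean (fun k => info s v k (i, j)))).
  rewrite -meanZ; apply: le_mean => s.
  rewrite (mean_resample i (fun v => mean (fun k => info s v k _))) ?card_bool//.
  rewrite -meanZ; apply: le_mean => v.
  apply: (@le_trans _ _ (16 * B%:R ^+ 2 * mean (fun k => info s (upd v i false) k (i, j)))).
    rewrite (mean_resample (i, j) (fun k => info _ _ k _) (card_steps B_gt0)) -meanZ.
    apply: le_mean => k; case: (eqVneq (s i) j) => [sj|sj].
      rewrite /= mul0r; apply: mulr_ge0; first by rewrite mulr_ge0 ?sqr_ge0.
      apply: mean_ge0 => x.
      exact: info_ge0.
    by rewrite /= mul1r; apply: (@info_coord s (upd v i false) k (i, j)); rewrite eq_sym.
  (* The half with [v i = true] is dropped, which turns the factor 16 into 32. *)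
  rewrite mean_bool.
  have h0 : 0 <= mean (fun k => info s (upd v i true) k (i, j)).
    by apply: mean_ge0 => k; exact: info_ge0.
  have B0 : 0 <= B%:R ^+ 2 :> R by exact: sqr_ge0.
  by have := mulr_ge0 B0 h0; lra.
rewrite mulr_sumr; apply: le_trans (ler_sum _ (fun j _ => coord j)).
have expand j : mean (fun s : S => mean (fun v : V => mean (fun k : K =>
    (s i != j)%:R * (1 - 2 * E false s v j k - 2 * E true s v j k)))) =
  mean (fun s : S => (s i != j)%:R)
  - 2 * mean (fun s : S => mean (fun v : V => mean (fun k : K => mean (fun u : U =>
    (s i != j)%:R * err i false (upd (plant s (upd v i false) (walk k u)) (i, j)
                              (ord0, planted_value B false))))))
  - 2 * mean (fun s : S => mean (fun v : V => mean (fun k : K => mean (fun u : U =>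
    (s i != j)%:R * err i true (upd (plant s (upd v i false) (walk k u)) (i, j)
                              (ord0, planted_value B true)))))).
  rewrite -!meanZ -!meanB; apply: eq_mean => s.
  rewrite -[X in X - _ - _](@mean_cst _ V)// -!meanZ -!meanB; apply: eq_mean => v.
  rewrite -[X in X - _ - _](@mean_cst _ K) ?card_walks// -!meanZ -!meanB.
  apply: eq_mean => k; rewrite !meanZ -/(E _ _ _ _ _) -/(E _ _ _ _ _); ring.
rewrite (eq_bigr _ (fun j _ => expand j)) !sumrB -!mulr_sumr.
have -> : \sum_j mean (fun s : S => (s i != j)%:R) = m%:R - 1 :> R.
  rewrite -mean_sum -[RHS](@mean_cst _ S)//; apply: eq_mean => s.
  rewrite (eq_bigr (fun j => 1 - (s i == j)%:R)); last by move=> j _; case: eqP => _ /=; ring.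
  rewrite sumrB sumr_const card_ord (bigD1 (s i))//= eqxx big1 ?addr0// => j.
  by rewrite eq_sym => /negPf ->.
have := err_double_plant i false m0 eta0 etam.
have := err_double_plant i true m0 eta0 etam.
lra.
Qed.

Lemma info_total (l : nat) : (#|T| <= 2 ^ l)%N -> (0 < m)%N ->
  \sum_c mean (fun s => mean (fun v => mean (fun k => info s v k c))) <= 8 * l%:R.
Proof.
move=> Tl m0.
have cardV : (0 < #|V|)%N by rewrite card_ffun card_bool expn_gt0.
have cardS : (0 < #|S|)%N by rewrite card_ffun card_ord expn_gt0 m0.
rewrite -mean_sum -[leRHS](@mean_cst _ S)//; apply: le_mean => s.
rewrite -mean_sum -[leRHS](@mean_cst _ V)//; apply: le_mean => v.
rewrite -mean_sum -[leRHS](@mean_cst _ K) ?card_walks//; apply: le_mean => k.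
rewrite /info exchange_big/=.
apply: (@level1 R _ T (fun t u => leaf t (plant s v (walk k u)))) => // u.
exact: leaf_sum.
Qed.

Lemma chi_mul (x y : bool) : chi R x * chi R y = 1 - 2 * (x != y)%:R.
Proof. by case: x; case: y; rewrite /chi /=; ring. Qed.

(** The level-1 inequality for the cube of planted answers [v], with all else fixed: outputs that
    agree with [v] force these bits to be biased given the leaf. *)
Lemma answers_bound (l : nat) : (#|T| <= 2 ^ l)%N -> (0 < m)%N ->
  \sum_i (3 / 4 - (err_given i true + err_given i false)) <= 8 * l%:R.
Proof.
move=> Tl m0.
have cardV : (0 < #|V|)%N by rewrite card_ffun card_bool expn_gt0.
have cardS : (0 < #|S|)%N by rewrite card_ffun card_ord expn_gt0 m0.
pose X s v k u : R := \sum_i (3 / 4 - 2 * err i (v i) (plant s v (walk k u))).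
have -> : \sum_i (3 / 4 - (err_given i true + err_given i false)) =
    mean (fun s => mean (fun v => mean (fun k => mean (fun u => X s v k u)))).
  under [RHS]eq_mean do under eq_mean do under eq_mean do rewrite mean_sum.
  under [RHS]eq_mean do under eq_mean do rewrite mean_sum.
  under [RHS]eq_mean do rewrite mean_sum.
  rewrite mean_sum; apply: eq_bigr => i _.
  rewrite (_ : err_given i true + _ = 2 * ((err_given i true + err_given i false) / 2)).
    rewrite -err_given_mean -!meanZ -[X in X - _](@mean_cst _ S)// -meanB.
    apply: eq_mean => s; rewrite -meanZ -[X in X - _](@mean_cst _ V)// -meanB.
    apply: eq_mean => v; rewrite -meanZ -[X in X - _](@mean_cst _ K) ?card_walks// -meanB.
    apply: eq_mean => k; rewrite -meanZ -[X in X - _](@mean_cst _ U) ?card_bits// -meanB.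
    exact: eq_mean.
  by field.
rewrite -[leRHS](@mean_cst _ S)//; apply: le_mean => s.
rewrite exchange_mean -[leRHS](@mean_cst _ K) ?card_walks//; apply: le_mean => k.
rewrite exchange_mean -[leRHS](@mean_cst _ U) ?card_bits//; apply: le_mean => u.
pose A t v := leaf t (plant s v (walk k u)).
have := @level1 R _ T A l (fun t v => leaf_ge0 t _) (fun v => leaf_sum _) Tl.
apply: le_trans; rewrite exchange_big mean_sum; apply: ler_sum => i _ /=.
(* Linearises the squared bias: [d^2 / p >= chi d - p / 4], from [(d - chi p / 2)^2 >= 0]. *)
apply: (@le_trans _ _ (\sum_t (chi R (out t i) * mean (fun v => A t v * chi R (v i)) -
    mean (A t) / 4))).
  rewrite sumrB -mulr_suml -mean_sum.
  rewrite [X in _ - X / 4](eq_mean (G := fun=> 1)) => [|v]; last exact: leaf_sum.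
  under eq_bigr do rewrite -meanZ.
  rewrite -mean_sum mean_cst// -[X in _ <= _ - X](@mean_cst _ V)// -meanB.
  apply: le_mean => v.
  rewrite (eq_bigr (fun t => A t v - 2 * (A t v * (out t i != v i)%:R))); last first.
    by move=> t _; rewrite mulrCA chi_mul; ring.
  by rewrite sumrB leaf_sum -mulr_sumr -/(err i (v i) _); lra.
apply: ler_sum => t _; set d := mean _; set p := mean _.
have A0 v : 0 <= A t v by exact: leaf_ge0.
have [p0|p0] := eqVneq p 0.
  rewrite p0 invr0 mulr0 mul0r subr0 -p0 -meanZ; apply: le_mean => v.
  by have := A0 v; rewrite /chi; do 2 case: ifP => _; lra.
have pp : 0 < p by rewrite lt_def p0 mean_ge0.
rewrite ler_pdivlMr//.
have : 0 <= (d - chi R (out t i) * p / 2) ^+ 2 by exact: sqr_ge0.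
by rewrite /chi; case: ifP => _; lra.
Qed.

End Protocol.

(** * Answers on planted instances, and the degenerate case B = 1 *)

Lemma staircase_dist (B n : nat) (x y : 'I_B.+1) : (n <= B.*2)%N ->
  (x, y) = staircase B n -> `|(x : nat)%:Z - (y : nat)%:Z|%N \in [:: 0; 1]%N.
Proof.
move=> nB /eqP; rewrite staircase_eq//= => /andP[/eqP -> /eqP ->].
by rewrite !inE; lia.
Qed.

(** Unplanted cells lie on the staircase, hence at distance at most 1; for B > 1 only the planted
    cell can be at distance B. *)
Lemma gap_plant (r B m : nat) (gap : vec B m -> vec B m -> bool)
    (k : {ffun 'I_r * 'I_m -> 'I_B.*2}) (u : {ffun 'I_r * 'I_m -> bool})
    (s : {ffun 'I_r -> 'I_m}) (v : {ffun 'I_r -> bool}) (i : 'I_r) :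
  is_gap_linf gap -> (1 < B)%N ->
  gap (alice (plant s v (walk k u)) i) (bob (plant s v (walk k u)) i) = v i.
Proof.
move=> gapP B1; set x := alice _ i; set y := bob _ i.
have far j : j != s i -> dist_at x y j \in [:: 0; 1]%N.
  move=> js; rewrite /dist_at /x /y !ffunE /= (negPf js).
  apply: (@staircase_dist _ (k (i, j) + u (i, j))); last exact/esym/surjective_pairing.
  by have := ltn_ord (k (i, j)); case: (u _); lia.
have near : dist_at x y (s i) = if v i then B else 0%N.
  by rewrite /dist_at /x /y !ffunE /= eqxx /planted_value; case: (v i) => /=; lia.
have [gap0 gap1] := gapP x y.
case vi: (v i) in near *; last first.
  apply: gap0 => j; have [->|/far//] := eqVneq j (s i).
  by rewrite near.
apply: gap1; exists (s i); split; last by move=> j /eqP/far.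
split=> // j jB; apply/eqP; apply: contraTT B1 => sj.
have : dist_at x y j \in [:: 0; 1]%N by apply: far; rewrite eq_sym.
by rewrite jB !inE; lia.
Qed.

(** Two vectors that differ by 1 in exactly one coordinate meet both promises. *)
Lemma gap_linf_B1 (m : nat) (gap : vec 1 m -> vec 1 m -> bool) :
  (0 < m)%N -> ~ is_gap_linf gap.
Proof.
case: m gap => // m gap _ gapP.
pose x : vec 1 m.+1 := [ffun j => if j == ord0 then ord_max else ord0].
pose y : vec 1 m.+1 := [ffun => ord0].
have xy j : dist_at x y j = (j == ord0).
  by rewrite /dist_at /x /y !ffunE; case: eqP.
have [gap0 gap1] := gapP x y.
have : gap x y = NO by apply: gap0 => j; rewrite xy; case: eqP.
rewrite gap1//; exists ord0; split; last by move=> j _; rewrite xy; case: eqP.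
split=> [|j]; rewrite xy ?eqxx//.
by case: eqP.
Qed.

(** By [exp_le] at 1/2, [exp (1/2) <= 2]. *)
Lemma ln_ge_half (R : realType) (m : nat) : (1 < m)%N -> 2^-1 <= ln (m%:R : R).
Proof.
move=> m1; rewrite -[leLHS]expRK ler_ln ?posrE ?expR_gt0 ?ltr0n 1?ltnW//.
have := @exp_le R 2^-1 (lexx _); have : 2 <= m%:R :> R by rewrite ler_nat.
lra.
Qed.

Theorem theorem2 (R : realType) :
  exists delta1 K c : R,
    [/\ 0 < delta1, 0 < K, 0 < c &
      forall (r B m : nat) (gap : vec B m -> vec B m -> bool),
        (1 <= r)%N -> (1 <= B)%N -> (1 <= m)%N ->
        is_gap_linf gap ->
        K * B%:R ^+ 2 * ln (m%:R) <= m%:R ->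
        ((c * (r%:R * m%:R / B%:R ^+ 2))%:E <=
           D_multi gap (@sigma_pow R r B m) delta1)%E].
Proof.
(* With [delta1 = 1/64] the errors [e i] sum to at most [4 delta1 r = r / 16]. As [ln m >= 1/2] for
   m > 1, this [K] gives [4 B <= eta^2 m] with [eta = 1/32]. The last constant comes from
   [r m / 4 <= 32 B^2 * 8 l]. *)
exists 64^-1, (2 * 64 ^+ 2), (32^-1 ^+ 2); split.
- by rewrite invr_gt0 ltr0n.
- by rewrite mulr_gt0 ?exprn_gt0 ?ltr0n.
- by rewrite exprn_gt0// invr_gt0 ltr0n.
move=> r B m gap r0 B0 m0 gapP mB.
have B1 : (1 < B)%N.
  rewrite ltn_neqAle B0 andbT; apply/eqP => B1.
  by case: _ / B1 gap gapP {mB B0} => gap; exact: gap_linf_B1.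
apply/ereal_infP => _ [p psolves <-]; rewrite lee_fin.
set l := max_bits p.
have [|T [a [b [out [Tl leafP]]]]] := @protocol_rectangles _ _ _ p l xpredT xpredT.
  by move=> x y _ _; exact: (leq_bigmax (x, y)).
have reach_sum x y : \sum_t reach R a b t x y = 1.
  have [t [_ tP]] := leafP x y isT isT.
  rewrite (bigD1 t)//= /reach tP eqxx big1 ?addr0// => t' tt'.
  by rewrite tP (negPf tt').
have errE i z W : err R a b out i z W = (run p (alice W) (bob W) i != z)%:R.
  have [t [-> tP]] := leafP (alice W) (bob W) isT isT.
  rewrite /err (bigD1 t)//= /leaf /reach tP eqxx mul1r big1 ?addr0// => t' tt'.
  by rewrite tP (negPf tt') mul0r.
pose e i := err_given R a b out i true + err_given R a b out i false.
pose good (w : vecs r B m * vecs r B m) := multi_correct gap (64^-1 : R) w.1 w.2 (run p w.1 w.2).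
have e_sum : \sum_i e i <= r%:R / 16.
  pose W (k : {ffun 'I_r * 'I_m -> 'I_B.*2}) (u : {ffun 'I_r * 'I_m -> bool})
    (s : {ffun 'I_r -> 'I_m}) (v : {ffun 'I_r -> bool}) : cells r B m :=
    plant s v (walk k u).
  (* A good run errs on at most r/64 copies, any other run on at most r. *)
  have wrong k u s (v : {ffun 'I_r -> bool}) : \sum_i err R a b out i (v i) (W k u s v) <=
      r%:R * (1 + 64^-1 - (good (alice (W k u s v), bob (W k u s v)))%:R).
    set g := good _.
    pose N := #|[set i | run p (alice (W k u s v)) (bob (W k u s v)) i == v i]|.
    have -> : \sum_i err R a b out i (v i) (W k u s v) = r%:R - N%:R.
      rewrite (eq_bigr (fun i => 1 -
        (run p (alice (W k u s v)) (bob (W k u s v)) i == v i)%:R)); last first.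
        by move=> i _; rewrite errE; case: eqP => _ /=; ring.
      rewrite sumrB sumr_const card_ord /N cardE -sum1_size big_filter natr_sum.
      congr (_ - _); rewrite big_mkcond [RHS]big_mkcond /=; apply: eq_bigr => i _.
      by rewrite inE; case: eqP.
    have r1 : 0 <= r%:R :> R by [].
    have : g -> (1 - 64^-1) * r%:R <= N%:R :> R.
      rewrite /g /good /multi_correct /N /= => h; apply: le_trans h _.
      rewrite ler_nat subset_leq_card//; apply/fintype.subsetP => i.
      by rewrite !inE gap_plant.
    case: g => [/(_ isT)|_] /=; first by lra.
    have : 0 <= N%:R :> R by [].
    by lra.
  have many : 1 - 64^-1 <= mean (fun k => mean (fun u => mean (fun s => mean (fun v =>
      (good (alice (W k u s v), bob (W k u s v)))%:R)))) :> R.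
    have /= <- := sigma_powE B0 (fun w => (good w)%:R : R).
    apply: le_trans psolves _; rewrite big_mkcond; apply: ler_sum => w _.
    by rewrite -/(good w); case: (good w); rewrite ?mulr1 ?mulr0.
  have cV : (0 < #|{ffun 'I_r -> bool}|)%N by rewrite card_ffun card_bool expn_gt0.
  have cS : (0 < #|{ffun 'I_r -> 'I_m}|)%N by rewrite card_ffun card_ord expn_gt0 m0.
  have -> : \sum_i e i = 2 * mean (fun k => mean (fun u => mean (fun s => mean (fun v : {ffun 'I_r -> bool} =>
      \sum_i err R a b out i (v i) (W k u s v))))).
    under eq_mean do under eq_mean do under eq_mean do rewrite mean_sum.
    under eq_mean do under eq_mean do rewrite mean_sum.
    under eq_mean do rewrite mean_sum.
    rewrite mean_sum mulr_sumr; apply: eq_bigr => i _.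
    transitivity (2 * ((err_given R a b out i true + err_given R a b out i false) / 2)).
      by rewrite /e; field.
    rewrite -err_given_mean; congr (2 * _).
    under [RHS]eq_mean do rewrite exchange_mean.
    rewrite [RHS]exchange_mean; apply: eq_mean => s.
    under [RHS]eq_mean do rewrite exchange_mean.
    by rewrite [RHS]exchange_mean.
  have : mean (fun k => mean (fun u => mean (fun s => mean (fun v : {ffun 'I_r -> bool} =>
      \sum_i err R a b out i (v i) (W k u s v))))) <=
    mean (fun k => mean (fun u => mean (fun s => mean (fun v =>
      r%:R * (1 + 64^-1 - (good (alice (W k u s v), bob (W k u s v)))%:R))))).
    by do 4 (apply: le_mean => ?); exact: wrong.
  rewrite [leRHS](_ : _ = r%:R * (1 + 64^-1 - mean (fun k => mean (fun u =>
      mean (fun s => mean (fun v => (good (alice (W k u s v), bob (W k u s v)))%:R)))))).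
    have r1 : 0 <= r%:R :> R by [].
    by have := ler_wpM2l r1 many; lra.
  rewrite -[X in X - _](@mean_cst _ {ffun 'I_r * 'I_m -> 'I_B.*2}) ?card_walks//.
  rewrite -meanB -meanZ; apply: eq_mean => k.
  rewrite -[X in X - _](@mean_cst _ {ffun 'I_r * 'I_m -> bool}) ?card_bits//.
  rewrite -meanB -meanZ; apply: eq_mean => u.
  rewrite -[X in X - _](@mean_cst _ {ffun 'I_r -> 'I_m})//.
  rewrite -meanB -meanZ; apply: eq_mean => s.
  rewrite -[X in X - _](@mean_cst _ {ffun 'I_r -> bool})//.
  by rewrite -meanB -meanZ.
have BB : 0 < B%:R ^+ 2 :> R by rewrite exprn_gt0 ?ltr0n.
rewrite mulrA ler_pdivrMr//.
(* For m = 1 the planted answers give [11 r / 16 <= 8 l], and [B^2 >= 1] finishes. *)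
have [m1|m1] := leqP m 1.
  have -> : m = 1%N by lia.
  have h : \sum_i (3 / 4 - e i) <= 8 * l%:R := answers_bound out B0 reach_sum Tl m0.
  rewrite sumrB sumr_const card_ord -[_ *+ r]mulr_natl in h; rewrite mulr1.
  have B2 : 1 <= B%:R ^+ 2 :> R by rewrite exprn_ege1// ler1n.
  have l0 : 0 <= l%:R :> R by [].
  have r0' : 0 <= r%:R :> R by [].
  by have := ler_wpM2l l0 B2; lra.
have m2 : 2 <= m%:R :> R by rewrite ler_nat.
have Bm : 4 * B%:R <= 32^-1 ^+ 2 * m%:R :> R.
  have B2 : B%:R <= B%:R ^+ 2 :> R by rewrite ler_eXnr ?ler1n.
  have := ler_wpM2l (ltW BB) (ln_ge_half R m1).
  by lra.
have eta0 : 0 < 32^-1 :> R by [].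
have tot : \sum_i \sum_j mean (fun s => mean (fun v => mean (fun k =>
    info R a b s v k (i, j)))) <= 8 * l%:R.
  apply: le_trans (info_total B0 reach_sum Tl m0).
  by rewrite pair_bigA; apply: ler_sum => -[].
have := ler_sum (P := xpredT) (index_enum 'I_r)
  (fun i _ => info_copy out B0 reach_sum i m0 eta0 Bm).
(* The term m/8 is [2 m * 2 eta]. The errors cost another r m/8 in total and [1 <= m/2], so at least
   r m/4 remains. *)
rewrite -mulr_sumr (eq_bigr (fun i =>
  (m%:R - 1 - 8^-1 * m%:R) - 2 * m%:R * e i)); last by move=> i _; rewrite /e; field.
rewrite sumrB -mulr_sumr sumr_const card_ord -[_ *+ r]mulr_natl => h.
have := ler_wpM2l (ltW BB) tot.
have m0' : 0 <= m%:R :> R by [].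
have r0' : 0 <= r%:R :> R by [].
have := ler_wpM2l m0' e_sum; have := ler_wpM2l r0' m2.
by lra.
Qed.
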